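(* Let $([0,1],T^{\pm})$ be a Lorenz system with critical point $q\in(0,1)$, and let $\alpha:=\tau_q^-(q)$, $\beta:=\tau_q^+(q)$. (i) If $T^-(q)=1$, then for each $a\in\mathbb{R}$ the following are equivalent: (a) $a\in(\exp(h(T)),2)$. (b) There exists a unique $p\in[1-a^{-1},a^{-1}]$, given by $p=a^{-1}$, such that $\alpha=\mu_{a,p}^{-}(p)\prec\mu_{a,p}^{+}(p)\prec\beta$. (c) There exists a unique $p\in[1-a^{-1},a^{-1}]$, given by $p=a^{-1}$, such that $\Omega_q^{-}\subset\Omega_{a,p}^{-}$ and $\Omega_q^{+}\subset\Omega_{a,p}^{+}$. (ii) If $T^+(q)=0$, then for each $a\in\mathbb{R}$ the following are equivalent: (a) $a\in(\exp(h(T)),2)$. (b) There exists a unique $p\in[1-a^{-1},a^{-1}]$, given by $p=1-a^{-1}$, such that $\alpha\prec\mu_{a,p}^{-}(p)\prec\mu_{a,p}^{+}(p)=\beta$. (c) There exists a unique $p\in[1-a^{-1},a^{-1}]$, given by $p=1-a^{-1}$, such that $\Omega_q^{-}\subset\Omega_{a,p}^{-}$ and $\Omega_q^{+}\subset\Omega_{a,p}^{+}$.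
   Context: Lorenz maps: let $q\in(0,1)$ and let $f_0:[0,q]\to[0,1]$, $f_1:[q,1]\to[0,1]$ be continuous strictly increasing functions with $f_0(0)=0$, $f_1(1)=1$ and either $1>f_0(q)>f_1(q)\ge 0$ or $1\ge f_0(q)>f_1(q)>0$, such that there is $s>1$ with $|f_i(x)-f_i(y)|\ge s|x-y|$ for $i\in\{0,1\}$ and all $x,y$ in the domain of $f_i$. The upper Lorenz map $T^+:[0,1]\to[0,1]$ with critical point $q$ equals $f_0$ on $[0,q)$ and $f_1$ on $[q,1]$; the lower Lorenz map $T^-$ equals $f_0$ on $[0,q]$ and $f_1$ on $(q,1]$. ''Lorenz system $([0,1],T^\pm)$'' means both $T^+$ and $T^-$, built from the same $f_0,f_1$. Itineraries: $\Omega=\{0,1\}^{\infty}$ is the set of infinite strings $\omega_0\omega_1\omega_2\cdots$ over $\{0,1\}$ with the lexicographic order $\prec,\preceq$. For $x\in[0,1]$, $\tau_q^+(x)=\omega_0\omega_1\cdots$ with $\omega_k=0$ if $(T^+)^k(x)<q$ and $\omega_k=1$ if $(T^+)^k(x)\ge q$; $\tau_q^-(x)=\sigma_0\sigma_1\cdots$ with $\sigma_k=0$ if $(T^-)^k(x)\le q$ and $\sigma_k=1$ if $(T^-)^k(x)>q$. The address spaces are $\Omega_q^\pm:=\tau_q^\pm([0,1])$. Entropy: $h(T^\pm):=\lim_{n\to\infty}\frac1n\ln|\Omega_{q,n}^\pm|$, where $\Omega_{q,n}^\pm$ is the set of length-$n$ prefixes of elements of $\Omega_q^\pm$. It is known that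 $h(T^+)=h(T^-)\le\ln 2$; the common value is denoted $h(T)$. Uniform Lorenz maps: $(a,p)$ is admissible if $a\in(1,2)$, $p\in(0,1)$ and $1-a^{-1}\le p\le a^{-1}$. For admissible $(a,p)$, $U_{a,p}^+(x)=ax$ for $0\le x<p$ and $ax+1-a$ for $p\le x\le1$; $U_{a,p}^-(x)=ax$ for $0\le x\le p$ and $ax+1-a$ for $p<x\le 1$. These are Lorenz maps with critical point $p$; their itinerary maps and address spaces are denoted $\mu_{a,p}^\pm$ and $\Omega_{a,p}^\pm=\mu_{a,p}^{\pm}([0,1])$. Conventions: $\subset$ denotes proper inclusion. The objects $\mu_{a,p}^\pm,\Omega_{a,p}^\pm$ are defined only for $a\in(1,2)$, so statements (b) and (c) are understood to include the requirement $a\in(1,2)$. *)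

(* Defs.v *)
From mathcomp Require Import all_boot all_order all_algebra.
From mathcomp Require Import all_classical all_reals all_analysis.

Set Implicit Arguments.
Unset Strict Implicit.
Unset Printing Implicit Defensive.

Import Order.TTheory GRing.Theory Num.Theory.
Import numFieldNormedType.Exports.

Local Open Scope classical_set_scope.
Local Open Scope ring_scope.

(* Elements of {0,1}^oo; false is the symbol 0 and true the symbol 1. *)
Definition string := nat -> bool.

Definition lex_lt (w v : string) : Prop :=
  exists n, [/\ forall k, (k < n)%N -> w k = v k, w n = false & v n = true].

Definition prefixes (A : set string) (n : nat) : set (n.-tuple bool) :=
  [set [tuple w i | i < n] | w in A].
Arguments prefixes : clear implicits.

Section Lorenz.
Context {R : realType}.
Implicit Types (q a p x : R).

(* f0 and f1 are total functions, but only their values on [0, q] and [q, 1]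
   respectively are constrained. *)
Definition lorenz_system q (f0 f1 : R -> R) : Prop :=
  [/\ 0 < q < 1,
      [/\ {within `[0, q], continuous f0},
          {in `[0, q] &, {homo f0 : x y / x < y}} &
          {in `[0, q], forall x, f0 x \in `[0, 1]}],
      [/\ {within `[q, 1], continuous f1},
          {in `[q, 1] &, {homo f1 : x y / x < y}} &
          {in `[q, 1], forall x, f1 x \in `[0, 1]}],
      [/\ f0 0 = 0, f1 1 = 1 &
          (1 > f0 q /\ f0 q > f1 q /\ f1 q >= 0) \/
          (1 >= f0 q /\ f0 q > f1 q /\ f1 q > 0)] &
      exists2 s : R, 1 < s &
        {in `[0, q] &, forall x y, s * `|x - y| <= `|f0 x - f0 y|} /\
        {in `[q, 1] &, forall x y, s * `|x - y| <= `|f1 x - f1 y|}].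

Definition lorenz_upper q (f0 f1 : R -> R) x : R :=
  if x < q then f0 x else f1 x.
Definition lorenz_lower q (f0 f1 : R -> R) x : R :=
  if x <= q then f0 x else f1 x.

Definition itin_upper q (f0 f1 : R -> R) x : string :=
  fun k => q <= iter k (lorenz_upper q f0 f1) x.
Definition itin_lower q (f0 f1 : R -> R) x : string :=
  fun k => q < iter k (lorenz_lower q f0 f1) x.

Definition addr_upper q (f0 f1 : R -> R) : set string :=
  itin_upper q f0 f1 @` `[0, 1].
Definition addr_lower q (f0 f1 : R -> R) : set string :=
  itin_lower q f0 f1 @` `[0, 1].

Definition string_entropy (A : set string) : R :=
  limn (fun n =>
    ln #|[pred w : n.-tuple bool | w \in prefixes A n]|%:R / n%:R : R).

(* For a Lorenz system the limit exists and addr_lower gives the same value,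
   so h(T) may be read off T^+. *)
Definition entropy q (f0 f1 : R -> R) : R :=
  string_entropy (addr_upper q f0 f1).

Definition unif0 a x : R := a * x.
Definition unif1 a x : R := a * x + 1 - a.

Definition mu_upper a p : R -> string := itin_upper p (unif0 a) (unif1 a).
Definition mu_lower a p : R -> string := itin_lower p (unif0 a) (unif1 a).

Definition unif_addr_upper a p : set string :=
  addr_upper p (unif0 a) (unif1 a).
Definition unif_addr_lower a p : set string :=
  addr_lower p (unif0 a) (unif1 a).

End Lorenz.

(* Main.v *)
(* A string w lies in the address space of a Lorenz map if and only if each of
   its shifts beginning with 0 is bounded above by alpha and each beginning with 1 is
   bounded below by beta (strictly or not according to the map): the inverse branches
   are contractions, so every string codes a point, monotonically, and these
   bounds are what makes the coded point follow the prescribed branches.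

   If T^-(q) = 1, then alpha = 0111..., and this forces p = 1/a for the uniform
   map.  With the same alpha on both sides, inclusion of the address spaces is
   just a comparison of beta with gamma = mu^+_{a,p}(p).  If beta <= gamma, the
   address space of T contains that of the uniform map, which has at least a^n
   words of length n because its cylinders have length at most a^-n; hence
   a <= exp h(T).  If gamma < beta, then beta = mu^+_{a,p}(y) for some y > p,
   and the words of T are accepted by the automaton recording the length of the
   current match with beta.  The function k |-> 1 + (1 - U^k y) / (a y - 1) is a
   strict supersolution of its counting recursion at rate a, so the words grow
   at a rate c < a.  The case T^+(q) = 0 follows by conjugation with
   x |-> 1 - x. *)
Require Import Defs.
From mathcomp Require Import all_boot all_order all_algebra.
From mathcomp Require Import all_classical all_reals all_analysis.
From mathcomp Require Import lra.

Import Order.TTheory GRing.Theory Num.Theory.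
Import numFieldNormedType.Exports.

Set Implicit Arguments.
Unset Strict Implicit.
Unset Printing Implicit Defensive.

Local Open Scope classical_set_scope.
Local Open Scope ring_scope.

(** * The lexicographic order on binary strings *)

Section Strings.
Implicit Types w v u : string.

Definition wshift i w : string := fun k => w (i + k)%N.
Definition compl w : string := fun k => ~~ w k.
Definition lex_le w v := lex_lt w v \/ w = v.

Lemma wshift0 w : wshift 0 w = w.
Proof. by []. Qed.

Lemma wshift_wshift i j w : wshift i (wshift j w) = wshift (j + i) w.
Proof. by apply/funext => k; rewrite /wshift addnA. Qed.

Lemma complK : involutive compl.
Proof. by move=> w; apply/funext => k; rewrite /compl negbK. Qed.

Lemma lex_lt_compl w v : lex_lt (compl w) (compl v) <-> lex_lt v w.
Proof.
suff hg u u' : lex_lt u u' -> lex_lt (compl u') (compl u).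
  by split=> [/hg|/hg //]; rewrite !complK.
case=> n [h un u'n]; exists n; rewrite /compl un u'n.
by split=> // k /h ->.
Qed.

Lemma first_difference w v :
  w = v \/ exists n, (forall k, (k < n)%N -> w k = v k) /\ w n <> v n.
Proof.
have [->|ne] := pselect (w = v); [by left | right].
have ex : exists n, w n != v n.
  apply: contrapT => /forallNP h; apply: ne; apply/funext => n.
  by apply/eqP/negPn/negP; exact: h.
case: (ex_minnP ex) => n /eqP wn hn; exists n; split => // k kn.
by apply/eqP/negPn/negP => /hn; rewrite leqNgt kn.
Qed.

Lemma lex_total w v : lex_lt w v \/ lex_le v w.
Proof.
have [->|[n [h]]] := first_difference w v; first by right; right.
case wn : (w n); case vn : (v n) => // _; [right; left|left]; exists n.
  by split=> // k /h ->.
by [].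
Qed.

Lemma lex_lt_irr w : ~ lex_lt w w.
Proof. by case=> n [_ ->]. Qed.

Lemma lex_lt_trans w v u : lex_lt w v -> lex_lt v u -> lex_lt w u.
Proof.
move=> [n [hn wn vn]] [m [hm vm um]]; case: (ltngtP n m) => [nm|mn|nm].
- exists n; split=> // [k kn|]; last by rewrite -hm.
  by rewrite hn // hm // (ltn_trans kn).
- exists m; split=> // [k km|]; last by rewrite hn.
  by rewrite hn ?hm // (ltn_trans km).
- by rewrite nm vm in vn.
Qed.

Lemma lex_le_lt_trans w v u : lex_le w v -> lex_lt v u -> lex_lt w u.
Proof. by case=> [|-> //]; exact: lex_lt_trans. Qed.

Lemma lex_lt_le_trans w v u : lex_lt w v -> lex_le v u -> lex_lt w u.
Proof. by move=> wv [|<- //]; exact: lex_lt_trans. Qed.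

Lemma lex_le_trans w v u : lex_le w v -> lex_le v u -> lex_le w u.
Proof. by case=> [wv vu|-> //]; left; exact: lex_lt_le_trans vu. Qed.

Lemma lex_le_wshift1 w v : w 0%N = v 0%N -> lex_le w v ->
  lex_le (wshift 1 w) (wshift 1 v).
Proof.
move=> e [[[|n] [h wn vn]]|->]; [by move: e; rewrite wn vn| |by right].
by left; exists n; split=> // k kn; apply: h.
Qed.

End Strings.

(** Powers of [s > 1] are unbounded by Bernoulli's inequality. This serves both to identify points
    with the same code and to compare exponential growth rates. *)
Lemma eq0_of_expr_le1 (R : realType) (s d : R) : 1 < s -> 0 <= d ->
  (forall m, s ^+ m * d <= 1) -> d = 0.
Proof.
move=> s1 d0 h; have s0 : 0 < s by rewrite (lt_trans _ s1).
 apply/eqP; rewrite eq_le d0 andbT leNgt; apply/negP => dp.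
have bern m : 1 + m%:R * (s - 1) <= s ^+ m.
  elim: m => [|m IH]; first by rewrite mul0r addr0.
  rewrite exprS; apply: le_trans (ler_wpM2l (ltW s0) IH).
  rewrite -natr1; have : 0 <= m%:R * (s - 1) ^+ 2 by rewrite mulr_ge0 ?sqr_ge0.
  by rewrite expr2; nra.
have e0 : 0 < (s - 1) * d by rewrite mulr_gt0 ?subr_gt0.
have [m hm] : exists m : nat, ((s - 1) * d)^-1 < m%:R.
  by exists (Num.truncn ((s - 1) * d)^-1).+1; rewrite truncnS_gt.
have : 1 < m%:R * ((s - 1) * d) by rewrite -ltr_pdivrMr // mul1r.
have := h m; have := bern m; nra.
Qed.

(** * Itineraries of expanding maps *)

Section CodedOrbits.
Context {R : realType}.
Context (q s : R) (f g : bool -> R -> R).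

(* The g b are the inverses of the branches f b, extended constantly outside
   the images of the branches. *)
Definition inverse_branches :=
  [/\ 0 < q < 1 /\ 1 < s,
      forall b x y, x <= y -> g b x <= g b y,
      forall b x y, s * `|g b x - g b y| <= `|x - y| &
      [/\ forall x, 0 <= x <= 1 -> 0 <= g false x <= q,
          forall x, 0 <= x <= 1 -> q <= g true x <= 1,
          forall x, 0 <= x <= q -> g false (f false x) = x /\ 0 <= f false x <= 1,
          forall x, q <= x <= 1 -> g true (f true x) = x /\ 0 <= f true x <= 1 &
          (forall y, 0 <= y <= f false q -> f false (g false y) = y) /\
          (forall y, f true q <= y <= 1 -> f true (g true y) = y)]].

Context (hg : inverse_branches).

Let q01 : 0 < q < 1. Proof. by case: hg => -[]. Qed.
Let s1 : 1 < s. Proof. by case: hg => -[]. Qed.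
Let s0 : 0 < s. Proof. by rewrite (lt_trans _ s1). Qed.

Lemma branch_homo b : {homo g b : x y / x <= y}.
Proof. by case: hg => _ h _ _ x y; exact: h. Qed.

Lemma branch_lip b x y : s * `|g b x - g b y| <= `|x - y|.
Proof. by case: hg. Qed.

Lemma branch_range b x : 0 <= x <= 1 -> 0 <= g b x <= 1.
Proof.
move=> hx; case: hg => _ _ _ [h0 h1 _ _ _].
by case: b; [have := h1 x hx|have := h0 x hx]; move: q01; lra.
Qed.

(** Orbits are described backwards, through inverse branches, so that a point equal to [q] may carry
    either symbol and the upper and lower maps are treated alike. *)
Definition coded_orbit (w : string) (x : nat -> R) :=
  forall i, 0 <= x i <= 1 /\ x i = g (w i) (x i.+1).

Lemma coded_orbit_dist w x w' x' m : coded_orbit w x -> coded_orbit w' x' ->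
  (forall k, (k < m)%N -> w k = w' k) ->
  s ^+ m * `|x 0%N - x' 0%N| <= `|x m - x' m|.
Proof.
move=> hx hx'; elim: m => [|m IH] hw; first by rewrite mul1r.
rewrite exprS -mulrA.
apply: le_trans (ler_wpM2l (ltW s0) (IH _)) _ => [k km|]; first by rewrite hw // ltnW.
by rewrite (hx m).2 (hx' m).2 hw //; exact: branch_lip.
Qed.

Lemma coded_orbit_unique w x x' :
  coded_orbit w x -> coded_orbit w x' -> x 0%N = x' 0%N.
Proof.
move=> hx hx'; apply/eqP; rewrite -subr_eq0 -normr_eq0; apply/eqP.
apply: (eq0_of_expr_le1 s1) => // m; apply: le_trans (coded_orbit_dist hx hx' _) _ => //.
by have := (hx m).1; have := (hx' m).1; rewrite ler_norml; lra.
Qed.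

(** A reversed inequality at time [n + 1] would be pulled back to time [n] by the monotone branch
    that both orbits share. *)
Lemma coded_orbit_lt w x w' x' : coded_orbit w x -> coded_orbit w' x' ->
  forall n, (forall k, (k < n)%N -> w k = w' k) -> x 0%N < x' 0%N -> x n < x' n.
Proof.
move=> hx hx'; elim=> // n IH hw /IH {}IH; rewrite ltNge; apply/negP => le.
have := IH (fun k kn => hw k (ltnW kn)).
by rewrite (hx n).2 (hx' n).2 hw // ltNge branch_homo.
Qed.

(** At the first difference the two points lie on opposite closed sides of [q], while a reversed
    strict order at time 0 would persist up to that index. *)
Lemma coded_orbit_mono w x w' x' : coded_orbit w x -> coded_orbit w' x' ->
  lex_le w w' -> x 0%N <= x' 0%N.
Proof.
move=> hx hx' [[n [hn wn w'n]]|e]; last first.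
  by rewrite -e in hx'; rewrite (coded_orbit_unique hx hx').
rewrite leNgt; apply/negP => /(coded_orbit_lt hx' hx) -/(_ n).
case: hg => _ _ _ [h0 h1 _ _ _].
rewrite (hx n).2 (hx' n).2 wn w'n => /(_ (fun k kn => esym (hn k kn))).
by have := h0 _ (hx n.+1).1; have := h1 _ (hx' n.+1).1; lra.
Qed.

(* Starting from 0, the pullbacks increase with m, so the
   coded point is their supremum. *)
Fixpoint approx (m : nat) (w : string) : R :=
  if m is m'.+1 then g (w 0%N) (approx m' (wshift 1 w)) else 0.

Lemma approx01 m w : 0 <= approx m w <= 1.
Proof. by elim: m w => [|m IH] w /=; [rewrite lexx ler01|exact: branch_range]. Qed.

Definition code_point w := sup (range (fun m => approx m w)).

Let approx_sup w : has_sup (range (fun m => approx m w)).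
Proof.
split; first by exists (approx 0 w), 0%N.
by exists 1 => _ [m _ <-]; case/andP: (approx01 m w).
Qed.

Lemma code_point_ge m w : approx m w <= code_point w.
Proof. by apply: ub_le_sup; [case: (approx_sup w)|exists m]. Qed.

Lemma code_point_le w c : (forall m, approx m w <= c) -> code_point w <= c.
Proof.
by move=> h; apply: ge_sup => [|_ [m _ <-] //]; case: (approx_sup w).
Qed.

Lemma code_point01 w : 0 <= code_point w <= 1.
Proof.
apply/andP; split; first exact: (code_point_ge 0).
by apply: code_point_le => m; case/andP: (approx01 m w).
Qed.

Lemma approx_incr m w : approx m w <= approx m.+1 w.
Proof.
by elim: m w => [|m IH] w; [case/andP: (approx01 1 w)|exact: branch_homo].
Qed.

Lemma code_pointE w : code_point w = g (w 0%N) (code_point (wshift 1 w)).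
Proof.
apply/eqP; rewrite eq_le; apply/andP; split.
  apply: code_point_le => m; apply: le_trans (approx_incr m w) _ => /=.
  exact/branch_homo/code_point_ge.
(* The supremum passes through [g] by continuity: an approximant within [e] of the shifted point is
   sent within [e / s < e] of its image. *)
apply/ler_addgt0Pr => e e0.
have [_ [m _ <-] hm] := sup_adherent e0 (approx_sup (wshift 1 w)).
have := code_point_ge m.+1 w => /=; rewrite -/(code_point _) in hm.
set y := code_point _ in hm *; set z := approx m _ in hm *.
have := branch_lip (w 0%N) y z.
have zy : z <= y by exact: code_point_ge.
rewrite (ger0_norm (_ : 0 <= y - z)) ?subr_ge0 //.
rewrite ger0_norm ?subr_ge0 ?branch_homo //.
have : 0 <= g (w 0%N) y - g (w 0%N) z by rewrite subr_ge0 branch_homo.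
by move: s1; nra.
Qed.

Lemma code_point_orbit w : coded_orbit w (fun i => code_point (wshift i w)).
Proof.
move=> i; split; first exact: code_point01.
by rewrite code_pointE wshift_wshift addn1 /wshift addn0.
Qed.

(* The value of c at q is left free: it is 1 for T^+ and 0 for T^-. *)
Definition coding (c : R -> bool) :=
  forall x, (x < q -> c x = false) /\ (q < x -> c x = true).

Definition step (c : R -> bool) x := f (c x) x.
Definition itin c x : string := fun k => c (iter k (step c) x).

Lemma wshift_itin c i x : wshift i (itin c x) = itin c (iter i (step c) x).
Proof. by apply/funext => k; rewrite /wshift /itin addnC iterD. Qed.

Lemma codingP c x : coding c -> 0 <= x <= 1 ->
  if c x then q <= x <= 1 else 0 <= x <= q.
Proof.
by move=> hc hx; case cx: (c x); case: (ltgtP x q) => h; try lra;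
  have [h1 h2] := hc x; move: cx; rewrite ?(h1 h) ?(h2 h).
Qed.

Lemma step_range c x : coding c -> 0 <= x <= 1 -> 0 <= step c x <= 1.
Proof.
move=> hc hx; case: hg => _ _ _ [_ _ h0 h1 _]; rewrite /step.
by have := codingP hc hx; case: (c x) => h; [case: (h1 _ h)|case: (h0 _ h)].
Qed.

Lemma iter_step_range c k x : coding c -> 0 <= x <= 1 ->
  0 <= iter k (step c) x <= 1.
Proof. by move=> hc hx; elim: k => //= k IH; exact: step_range. Qed.

Lemma itin_orbit c x : coding c -> 0 <= x <= 1 ->
  coded_orbit (itin c x) (fun k => iter k (step c) x).
Proof.
move=> hc hx k; have hk := iter_step_range k hc hx; split=> //=.
rewrite /itin; case: hg => _ _ _ [_ _ h0 h1 _]; rewrite {3}/step.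
by have := codingP hc hk; case: (c _) => h; [case: (h1 _ h)|case: (h0 _ h)].
Qed.

(** Two codings appear so that itineraries under the upper and the lower map can be compared with
    each other. Equal itineraries would code the same point; at a first difference the order of the
    orbit points decides. *)
Lemma itin_lt c c' x y : coding c -> coding c' ->
  0 <= x <= 1 -> 0 <= y <= 1 -> x < y -> lex_lt (itin c x) (itin c' y).
Proof.
move=> hc hc' hx hy xy.
have ox := itin_orbit hc hx; have oy := itin_orbit hc' hy.
have [e|[n [hn]]] := first_difference (itin c x) (itin c' y).
  rewrite e in ox; have /= e' := coded_orbit_unique ox oy.
  by move: xy; rewrite e' ltxx.
have := coded_orbit_lt ox oy hn xy.
have := codingP hc (ox n).1; have := codingP hc' (oy n).1.
rewrite -/(itin c x n) -/(itin c' y n).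
case xn: (itin c x n); case yn: (itin c' y n) => //.
  by lra.
by move=> _ _ _ _; exists n.
Qed.

Lemma itin_le c x y : coding c -> 0 <= x <= 1 -> 0 <= y <= 1 -> x <= y ->
  lex_le (itin c x) (itin c y).
Proof.
move=> hc hx hy; rewrite le_eqVlt => /predU1P[->|xy]; first by right.
by left; exact: itin_lt.
Qed.

(** * Kneading sequences and admissible strings *)

Definition upper_code x := q <= x.
Definition lower_code x := q < x.

Lemma coding_upper : coding upper_code.
Proof. by move=> x; rewrite /upper_code; split=> h; [rewrite leNgt h|rewrite ltW]. Qed.

Lemma coding_lower : coding lower_code.
Proof. by move=> x; rewrite /lower_code; split=> h //; rewrite ltNge ltW. Qed.

Let q01' : 0 <= q <= 1. Proof. by move: q01; lra. Qed.

Definition lower_kneading := itin lower_code q.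
Definition upper_kneading := itin upper_code q.

Lemma lower_kneading0 : lower_kneading 0 = false.
Proof. by rewrite /lower_kneading /itin /= /lower_code ltxx. Qed.

Lemma upper_kneading0 : upper_kneading 0 = true.
Proof. by rewrite /upper_kneading /itin /= /upper_code lexx. Qed.

(** Both bounds are non-strict, so the conditions for either map imply this one; strictness matters
    only where the coded orbit meets [q]. *)
Definition weakly_admissible w :=
  forall i, (w i = false -> lex_le (wshift i w) lower_kneading) /\
            (w i = true -> lex_le upper_kneading (wshift i w)).

Lemma coding_cases c : coding c -> c = lower_code \/ c = upper_code.
Proof.
move=> hc; case cq: (c q); [right|left]; apply/funext => x; have [h1 h2] := hc x.
  rewrite /upper_code; case: (ltgtP x q) => [/h1|/h2|->] //.
by rewrite /lower_code; case: (ltgtP x q) => [/h1|/h2|->].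
Qed.

Lemma itin_admissible c x : coding c -> 0 <= x <= 1 ->
  forall i, if c q then
    (itin c x i = false -> lex_lt (wshift i (itin c x)) lower_kneading) /\
    (itin c x i = true -> lex_le upper_kneading (wshift i (itin c x)))
  else
    (itin c x i = false -> lex_le (wshift i (itin c x)) lower_kneading) /\
    (itin c x i = true -> lex_lt upper_kneading (wshift i (itin c x))).
Proof.
move=> hc hx i; rewrite wshift_itin {1 3 5 7}/itin; set y := iter i _ x.
have hy : 0 <= y <= 1 by exact: iter_step_range.
case: (coding_cases hc) => e; rewrite e in hc *.
  rewrite /lower_code ltxx /=; split => [/negbT|yq]; last exact: itin_lt coding_upper _ _ _ _.
  by rewrite -leNgt => yq; exact: itin_le.
rewrite /upper_code lexx /=; split => [/negbT|yq]; last exact: itin_le.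
by rewrite -ltNge => yq; exact: itin_lt coding_lower _ _ _.
Qed.

Lemma code_point_itin c x : coding c -> 0 <= x <= 1 -> code_point (itin c x) = x.
Proof.
move=> hc hx.
exact: coded_orbit_unique (code_point_orbit _) (itin_orbit hc hx).
Qed.

Lemma code_point_homo w v : lex_le w v -> code_point w <= code_point v.
Proof. exact: coded_orbit_mono (code_point_orbit w) (code_point_orbit v). Qed.

(** [f] undoes [g] only on the image of a branch. The admissibility bound on [w], shifted by one
    symbol, is what puts the next coded point into that image. *)
Lemma code_point_step w : weakly_admissible w ->
  code_point (wshift 1 w) = f (w 0%N) (code_point w).
Proof.
move=> /(_ 0%N); rewrite wshift0 => -[w0 w1]; rewrite [code_point w]code_pointE.
case: hg => _ _ _ [_ _ _ _ [h0 h1]].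
case e : (w 0%N); rewrite ?h0 ?h1 //; apply/andP; split.
- have := lex_le_wshift1 _ (w1 e); rewrite upper_kneading0 e => /(_ erefl).
  move/code_point_homo; rewrite wshift_itin code_point_itin //.
    by rewrite /= /step /upper_code lexx.
  + exact: coding_upper.
  + exact: (iter_step_range 1 coding_upper).
- by case/andP: (code_point01 (wshift 1 w)).
- by case/andP: (code_point01 (wshift 1 w)).
- have := lex_le_wshift1 _ (w0 e); rewrite lower_kneading0 e => /(_ erefl).
  move/code_point_homo; rewrite wshift_itin code_point_itin //.
    by rewrite /= /step /lower_code ltxx.
  + exact: coding_lower.
  + exact: (iter_step_range 1 coding_lower).
Qed.

Lemma weakly_admissible_wshift i w : weakly_admissible w ->
  weakly_admissible (wshift i w).
Proof. by move=> hw k; rewrite wshift_wshift; exact: hw. Qed.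

Lemma code_point_iter w c k : weakly_admissible w ->
  (forall j, (j < k)%N -> w j = itin c (code_point w) j) ->
  code_point (wshift k w) = iter k (step c) (code_point w).
Proof.
move=> hw; elim: k => [//|k IH] h.
rewrite -addn1 -wshift_wshift code_point_step; last exact: weakly_admissible_wshift.
rewrite addn1 /= -IH => [|j jk]; last by rewrite h // ltnW.
by rewrite /wshift addn0 h // /itin -IH // => j jk; rewrite h // ltnW.
Qed.

Lemma code_point_side w : if w 0%N then q <= code_point w else code_point w <= q.
Proof.
case: hg => _ _ _ [h0 h1 _ _ _]; rewrite code_pointE.
by case: (w 0%N); [case/andP: (h1 _ (code_point01 (wshift 1 w)))|
                   case/andP: (h0 _ (code_point01 (wshift 1 w)))].
Qed.

(** At a first difference [n] from the kneading sequence, the bound forces [w n] to be 1 in the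
    upper case and 0 in the lower case. The [n]-th image of [q] then lies on the closed side of that
    symbol, all of which the coding at hand gives the same symbol, a contradiction. *)
Lemma kneading_of_critical_point w : weakly_admissible w -> code_point w = q ->
  w = if w 0%N then upper_kneading else lower_kneading.
Proof.
move=> hw wq; have := hw 0%N; rewrite wshift0.
case: (w 0%N) => -[h0 h1].
  case: (h1 erefl) => [[n [hn bn wn]]|//].
  have := code_point_iter (c := upper_code) hw; rewrite wq => /(_ n).
  have := code_point_side (wshift n w); rewrite /wshift addn0 wn => + e.
  rewrite e => [le|j jn]; last by rewrite -hn.
  by move: bn; rewrite /upper_kneading /itin /upper_code le.
case: (h0 erefl) => [[n [hn wn an]]|//].
have := code_point_iter (c := lower_code) hw; rewrite wq => /(_ n).
have := code_point_side (wshift n w); rewrite /wshift addn0 wn => + e.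
rewrite e => [le|j jn]; last by rewrite hn.
by move: an; rewrite /lower_kneading /itin /lower_code ltNge le.
Qed.

(** As long as the symbols agree, the iterates are the coded points of the shifts. Away from [q]
    such a point determines its symbol by its side; the hypothesis settles the symbol at [q]. *)
Lemma itin_code_point c w : coding c -> weakly_admissible w ->
  (forall i, code_point (wshift i w) = q -> w i = c q) -> itin c (code_point w) = w.
Proof.
move=> hc hw hq; apply/funext => n.
elim/ltn_ind: n => n IH; rewrite /itin -code_point_iter // => [|j jn]; last first.
  by rewrite IH.
have := code_point_side (wshift n w); rewrite {1}/wshift addn0 => side.
have [h1 h2] := hc (code_point (wshift n w)).
case: (ltgtP (code_point (wshift n w)) q) => [lt|lt|e].
- by rewrite h1 //; move: side; case: (w n) => //; rewrite leNgt lt.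
- by rewrite h2 //; move: side; case: (w n) => //; rewrite leNgt lt.
- by rewrite e hq.
Qed.

(** The only weakly admissible code of [q] with the wrong first symbol is the lower kneading
    sequence, and the strict bound excludes it. *)
Lemma upper_itinP w : (exists2 x, 0 <= x <= 1 & itin upper_code x = w) <->
  forall i, (w i = false -> lex_lt (wshift i w) lower_kneading) /\
            (w i = true -> lex_le upper_kneading (wshift i w)).
Proof.
split=> [[x hx <-] i|h].
  by have := itin_admissible coding_upper hx i; rewrite {1}/upper_code lexx.
have hw : weakly_admissible w.
  by move=> i; have [h0 h1] := h i; split=> [/h0|//]; left.
exists (code_point w); first exact: code_point01.
apply: itin_code_point => // [|i]; first exact: coding_upper.
move/kneading_of_critical_point => /(_ (@weakly_admissible_wshift i _ hw)).
rewrite {2}/wshift addn0 /upper_code lexx; case e: (w i) => // a.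
by have := (h i).1 e; rewrite a => /lex_lt_irr.
Qed.

Lemma lower_itinP w : (exists2 x, 0 <= x <= 1 & itin lower_code x = w) <->
  forall i, (w i = false -> lex_le (wshift i w) lower_kneading) /\
            (w i = true -> lex_lt upper_kneading (wshift i w)).
Proof.
split=> [[x hx <-] i|h].
  by have := itin_admissible coding_lower hx i; rewrite {1}/lower_code ltxx.
have hw : weakly_admissible w.
  by move=> i; have [h0 h1] := h i; split=> [//|/h1]; left.
exists (code_point w); first exact: code_point01.
apply: itin_code_point => // [|i]; first exact: coding_lower.
move/kneading_of_critical_point => /(_ (@weakly_admissible_wshift i _ hw)).
rewrite {2}/wshift addn0 /lower_code ltxx; case e: (w i) => // a.
by have := (h i).2 e; rewrite a => /lex_lt_irr.
Qed.

End CodedOrbits.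

(** * Lorenz systems and their reflection *)

Section LorenzSystems.
Context {R : realType}.
Implicit Types (q s l r x y a p : R).

Definition branch (f0 f1 : R -> R) b := if b then f1 else f0.

Lemma clamped_inverse l r s (f : R -> R) : l < r -> 1 < s ->
  {within `[l, r], continuous f} ->
  {in `[l, r] &, {homo f : x y / x < y}} ->
  {in `[l, r] &, forall x y, s * `|x - y| <= `|f x - f y|} ->
  exists g : R -> R,
    [/\ forall y, l <= g y <= r,
        {homo g : x y / x <= y},
        forall x y, s * `|g x - g y| <= `|x - y|,
        forall x, l <= x <= r -> g (f x) = x &
        forall y, f l <= y <= f r -> f (g y) = y].
Proof.
move=> lr s1 cf mf ef.
have flr : f l < f r by apply: mf => //; rewrite in_itv /= lexx ltW.
(* Clamping to the image of [f] is monotone and 1-Lipschitz, so the inverse composed with it stays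
   monotone and contracts by [1 / s] on the whole line. *)
pose clamp y := if y <= f l then f l else if f r <= y then f r else y.
have clampE y : f l <= clamp y <= f r.
  by rewrite /clamp; case: (leP y (f l)) => h1; case: (leP (f r) y) => h2; lra.
have clamp_id y : f l <= y <= f r -> clamp y = y.
  by rewrite /clamp; case: (leP y (f l)) => h1; case: (leP (f r) y) => h2; lra.
have clamp_le x y : x <= y -> 0 <= clamp y - clamp x <= y - x.
  move=> xy; rewrite /clamp; case: (leP y (f l)) => h1.
    by rewrite (le_trans xy h1); lra.
  case: (leP (f r) y) => h2; case: (leP x (f l)) => h3; try lra;
  by case: (leP (f r) x) => h4; lra.
have ex y : exists x, x \in `[l, r] /\ f x = clamp y.
  have [|x xlr fx] := IVT (ltW lr) cf (v := clamp y); last by exists x.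
  by rewrite (min_idPl (ltW flr)) (max_idPr (ltW flr)).
have [g gE] := choice ex.
have glr y : l <= g y <= r by have := (gE y).1; rewrite in_itv.
have inj x y : x \in `[l, r] -> y \in `[l, r] -> f x = f y -> x = y.
  by move=> hx hy e; case: (ltgtP x y) => // [/(mf _ _ hx hy)|/(mf _ _ hy hx)]; rewrite e ltxx.
exists g; split=> // [x y xy|x y|x hx|y hy].
- rewrite leNgt; apply/negP => /(mf _ _ (gE y).1 (gE x).1).
  by rewrite (gE x).2 (gE y).2; have := clamp_le _ _ xy; lra.
- apply: le_trans (ef _ _ (gE x).1 (gE y).1) _; rewrite (gE x).2 (gE y).2.
  wlog xy : x y / x <= y => [hw|].
    have [/hw //|/ltW/hw] := leP x y.
    by rewrite distrC [leRHS]distrC.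
  by rewrite distrC [leRHS]distrC !ger0_norm; have := clamp_le _ _ xy; lra.
- have xlr : x \in `[l, r] by rewrite in_itv.
  apply: inj => //; [exact: (gE _).1|rewrite (gE _).2 clamp_id //].
  rewrite !le_eqVlt; apply/andP; split.
    have [->|ne] := eqVneq l x; first by rewrite eqxx.
    by rewrite mf ?orbT // ?in_itv /= ?lexx ?(ltW lr) //; move: ne; rewrite neq_lt; lra.
  have [->|ne] := eqVneq x r; first by rewrite eqxx.
  by rewrite mf ?orbT // ?in_itv /= ?lexx ?(ltW lr) //; move: ne; rewrite neq_lt; lra.
- by rewrite (gE y).2 clamp_id.
Qed.

Lemma lorenz_inverse_branches q (f0 f1 : R -> R) : lorenz_system q f0 f1 ->
  exists s g, inverse_branches q s (branch f0 f1) g.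
Proof.
case=> q01 [c0 m0 r0] [c1 m1 r1] [f00 f11 _] [s s1 [e0 e1]].
have q0 : 0 < q by case/andP: q01.
have q1 : q < 1 by case/andP: q01.
have [g0 [a1 a2 a3 a4 a5]] := clamped_inverse q0 s1 c0 m0 e0.
have [g1 [b1 b2 b3 b4 b5]] := clamped_inverse q1 s1 c1 m1 e1.
exists s, (branch g0 g1); split=> // [[] x y|[] x y|]; rewrite /branch.
- exact: b2.
- exact: a2.
- exact: b3.
- exact: a3.
split=> // [x hx|x hx|].
- by split; [exact: a4|have := r0 x; rewrite !in_itv; exact].
- by split; [exact: b4|have := r1 x; rewrite !in_itv; exact].
by split=> y hy; [rewrite a5 // f00|rewrite b5 // f11].
Qed.

Lemma lorenz_upperE q (f0 f1 : R -> R) : lorenz_upper q f0 f1 = step (branch f0 f1) (upper_code q).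
Proof. by apply/funext => x; rewrite /lorenz_upper /step /upper_code leNgt; case: ltP. Qed.

Lemma lorenz_lowerE q (f0 f1 : R -> R) : lorenz_lower q f0 f1 = step (branch f0 f1) (lower_code q).
Proof. by apply/funext => x; rewrite /lorenz_lower /step /lower_code ltNge; case: leP. Qed.

Lemma itin_upperE q (f0 f1 : R -> R) : itin_upper q f0 f1 = itin (branch f0 f1) (upper_code q).
Proof. by apply/funext => x; rewrite /itin_upper lorenz_upperE. Qed.

Lemma itin_lowerE q (f0 f1 : R -> R) : itin_lower q f0 f1 = itin (branch f0 f1) (lower_code q).
Proof. by apply/funext => x; rewrite /itin_lower lorenz_lowerE. Qed.

Lemma unif_lorenz_system a p : 1 < a < 2 -> 1 - a^-1 <= p <= a^-1 ->
  lorenz_system p (unif0 a) (unif1 a).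
Proof.
move=> a12 hp.
have a0 : 0 < a by lra.
have aV : a * a^-1 = 1 by rewrite divff // gt_eqF.
have iV : 0 < a^-1 by rewrite invr_gt0.
have p01 : 0 < p < 1 by nra.
have ap : a - 1 <= a * p <= 1 by nra.
split=> //.
- split.
  + by apply: continuous_subspaceT => x; exact: mulrl_continuous.
  + by move=> x y _ _ xy; rewrite /unif0 ltr_pM2l.
  + move=> x; rewrite !in_itv /= /unif0 => /andP[x0 xp].
    by rewrite (mulr_ge0 (ltW a0) x0); have := ler_wpM2l (ltW a0) xp; lra.
- split.
  + apply: continuous_subspaceT => x; apply: cvgB; last exact: cvg_cst.
    by apply: cvgD; [exact: mulrl_continuous|exact: cvg_cst].
  + by move=> x y _ _ xy; rewrite /unif1 ltrD2r ltrD2r ltr_pM2l.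
  + move=> x; rewrite !in_itv /= /unif1 => /andP[px x1].
    by have := ler_wpM2l (ltW a0) px; have := ler_wpM2l (ltW a0) x1; lra.
- rewrite /unif0 /unif1; split; [by rewrite mulr0|by lra|].
  (* The jump is [a - 1 > 0]. If [a * p = 1], the right branch starts at [2 - a > 0], which is the
     second alternative. *)
  case: (ltP (a * p) 1) => h; [left|right]; split; try split; lra.
exists a; first lra; split=> x y _ _; rewrite /unif0 /unif1.
  by rewrite -mulrBr normrM gtr0_norm.
rewrite (_ : a * x + 1 - a - (a * y + 1 - a) = a * (x - y)); last lra.
by rewrite normrM gtr0_norm.
Qed.

(** Conjugation by [x |-> 1 - x]. It swaps the two branches and reverses the convention at the
    critical point, so it exchanges upper and lower maps. *)
Definition flip (f : R -> R) x := 1 - f (1 - x).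

Lemma flip_within_continuous l r (f : R -> R) :
  {within `[l, r], continuous f} ->
  {within `[1 - r, 1 - l], continuous (flip f)}.
Proof.
move=> /subspace_continuousP cf; apply/subspace_continuousP => x hx; rewrite /from_subspace.
apply: cvgB; first exact: cvg_cst.
have hx' : [set` `[l, r]] (1 - x) by move: hx; rewrite /= !in_itv /=; lra.
apply: (@cvg_comp _ _ _ (fun y : R => 1 - y) f _ _ _ _ (cf _ hx')) => P.
rewrite /within /nbhs_simpl /= => hP.
have : (1 - y) @[y --> x] --> 1 - x by apply: cvgB; [exact: cvg_cst|exact: cvg_id].
move=> /(_ _ hP) h.
have {}h : \forall y \near x, 1 - y \in `[l, r] -> P (1 - y) by exact: h.
suff : \forall y \near x, y \in `[1 - r, 1 - l] -> P (1 - y) by [].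
apply: filterS h => y hy yA; apply: hy.
by move: yA; rewrite /= !in_itv /=; lra.
Qed.

Lemma flip_lorenz_system q (f0 f1 : R -> R) : lorenz_system q f0 f1 ->
  lorenz_system (1 - q) (flip f1) (flip f0).
Proof.
case=> q01 [c0 m0 r0] [c1 m1 r1] [f00 f11 jump] [s s1 [e0 e1]]; split.
- by lra.
- split.
  + by have := flip_within_continuous c1; rewrite subrr.
  + move=> x y; rewrite !in_itv /= => hx hy xy.
    by rewrite /flip ltrD2l ltrN2; apply: m1; rewrite ?in_itv /=; lra.
  + move=> x; rewrite !in_itv /= /flip => hx.
    by have := r1 (1 - x); rewrite !in_itv /=; lra.
- split.
  + by have := flip_within_continuous c0; rewrite subr0.
  + move=> x y; rewrite !in_itv /= => hx hy xy.
    by rewrite /flip ltrD2l ltrN2; apply: m0; rewrite ?in_itv /=; lra.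
  + move=> x; rewrite !in_itv /= /flip => hx.
    by have := r0 (1 - x); rewrite !in_itv /=; lra.
(* The two alternatives of the jump condition trade places. *)
- by rewrite /flip subr0 subrr f11 f00 subKr; split; lra.
exists s => //; split=> x y; rewrite !in_itv /= /flip => hx hy.
- rewrite distrC [leRHS]distrC.
  have := e1 (1 - x) (1 - y); rewrite !in_itv /=.
  rewrite (_ : 1 - x - (1 - y) = y - x); last lra.
  rewrite (_ : _ - _ - (_ - _) = f1 (1 - x) - f1 (1 - y)); last lra.
  by apply; lra.
- rewrite distrC [leRHS]distrC.
  have := e0 (1 - x) (1 - y); rewrite !in_itv /=.
  rewrite (_ : 1 - x - (1 - y) = y - x); last lra.
  rewrite (_ : _ - _ - (_ - _) = f0 (1 - x) - f0 (1 - y)); last lra.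
  by apply; lra.
Qed.

Lemma flip_unif0 a : flip (unif0 a) = unif1 a.
Proof. by apply/funext => x; rewrite /flip /unif0 /unif1; lra. Qed.

Lemma flip_unif1 a : flip (unif1 a) = unif0 a.
Proof. by apply/funext => x; rewrite /flip /unif0 /unif1; lra. Qed.

Lemma flip_step_upper q (f0 f1 : R -> R) x :
  step (branch (flip f1) (flip f0)) (upper_code (1 - q)) (1 - x) =
  1 - step (branch f0 f1) (lower_code q) x.
Proof.
rewrite /step /upper_code /lower_code lerD2l lerN2 ltNge.
by case: (x <= q); rewrite /= /flip subKr.
Qed.

Lemma flip_step_lower q (f0 f1 : R -> R) x :
  step (branch (flip f1) (flip f0)) (lower_code (1 - q)) (1 - x) =
  1 - step (branch f0 f1) (upper_code q) x.
Proof.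
rewrite /step /upper_code /lower_code ltrD2l ltrN2 leNgt.
by case: (x < q); rewrite /= /flip subKr.
Qed.

Lemma flip_itin_upper q (f0 f1 : R -> R) x :
  itin_upper (1 - q) (flip f1) (flip f0) (1 - x) = compl (itin_lower q f0 f1 x).
Proof.
rewrite itin_upperE itin_lowerE; apply/funext => k; rewrite /itin /compl.
have -> : iter k (step (branch (flip f1) (flip f0)) (upper_code (1 - q))) (1 - x) =
    1 - iter k (step (branch f0 f1) (lower_code q)) x.
  by elim: k => //= k ->; rewrite flip_step_upper.
by rewrite /upper_code /lower_code lerD2l lerN2 ltNge negbK.
Qed.

Lemma flip_itin_lower q (f0 f1 : R -> R) x :
  itin_lower (1 - q) (flip f1) (flip f0) (1 - x) = compl (itin_upper q f0 f1 x).
Proof.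
rewrite itin_upperE itin_lowerE; apply/funext => k; rewrite /itin /compl.
have -> : iter k (step (branch (flip f1) (flip f0)) (lower_code (1 - q))) (1 - x) =
    1 - iter k (step (branch f0 f1) (upper_code q)) x.
  by elim: k => //= k ->; rewrite flip_step_lower.
by rewrite /upper_code /lower_code ltrD2l ltrN2 leNgt negbK.
Qed.

Lemma flip_addr_upper q (f0 f1 : R -> R) :
  addr_upper (1 - q) (flip f1) (flip f0) = compl @` addr_lower q f0 f1.
Proof.
apply/seteqP; split=> w [x].
  rewrite /= in_itv /= => hx <-; exists (itin_lower q f0 f1 (1 - x)).
    by exists (1 - x); rewrite //= in_itv /=; lra.
  by rewrite -flip_itin_upper subKr.
move=> [y]; rewrite /= in_itv /= => hy <- <-.
by exists (1 - y); rewrite ?flip_itin_upper //= in_itv /=; lra.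
Qed.

Lemma flip_addr_lower q (f0 f1 : R -> R) :
  addr_lower (1 - q) (flip f1) (flip f0) = compl @` addr_upper q f0 f1.
Proof.
apply/seteqP; split=> w [x].
  rewrite /= in_itv /= => hx <-; exists (itin_upper q f0 f1 (1 - x)).
    by exists (1 - x); rewrite //= in_itv /=; lra.
  by rewrite -flip_itin_lower subKr.
move=> [y]; rewrite /= in_itv /= => hy <- <-.
by exists (1 - y); rewrite ?flip_itin_lower //= in_itv /=; lra.
Qed.

End LorenzSystems.

(** * Word counts and entropy *)

Section WordCounts.
Implicit Types (A : set string) (b w : string).

Definition word_count A n := #|[pred w : n.-tuple bool | w \in prefixes A n]|.

Lemma word_count_gt0 A n : A !=set0 -> (0 < word_count A n)%N.
Proof.
case=> w Aw; apply/card_gt0P; exists [tuple w i | i < n].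
by rewrite !inE; exists w.
Qed.

Lemma word_count_le A B n : A `<=` B -> (word_count A n <= word_count B n)%N.
Proof.
move=> AB; apply: subset_leq_card; apply/fintype.subsetP => w; rewrite !inE.
by move=> [u /AB Bu <-]; exists u.
Qed.

(** Cutting a word after [m] letters is injective, and shift invariance makes the second piece a
    prefix of an element of [A] as well. *)
Lemma word_count_submul A m n : (forall (i : nat) w, A w -> A (wshift i w)) ->
  (word_count A (m + n) <= word_count A m * word_count A n)%N.
Proof.
move=> hA; pose f (w : (m + n).-tuple bool) :=
  ([tuple tnth w (lshift n i) | i < m], [tuple tnth w (rshift m i) | i < n]).
have fI : injective f.
  move=> u v e; apply: eq_from_tnth => i; rewrite -(splitK i); case: (fintype.split i) => j /=.
    by move/(congr1 (fun p => tnth p.1 j)): e; rewrite !tnth_mktuple.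
  by move/(congr1 (fun p => tnth p.2 j)): e; rewrite !tnth_mktuple.
rewrite /word_count -cardX -(fintype.card_image fI); apply: subset_leq_card.
apply/fintype.subsetP => _ /fintype.imageP[w + ->]; rewrite !inE => -[u Au uw].
apply/andP; split; rewrite inE; [exists u|exists (wshift m u)]; rewrite //= -?uw;
  try exact: hA; by apply: eq_from_tnth => i; rewrite !tnth_mktuple.
Qed.

Lemma word_count_compl A n : word_count (compl @` A) n = word_count A n.
Proof.
have le B : (word_count (compl @` B) n <= word_count B n)%N.
  pose f (w : n.-tuple bool) := [tuple ~~ tnth w i | i < n].
  have fI : injective f.
    move=> u v e; apply: eq_from_tnth => i.
    by move/(congr1 (fun p => tnth p i)): e; rewrite !tnth_mktuple => /negb_inj.
  rewrite /word_count -(fintype.card_image fI); apply: subset_leq_card.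
  apply/fintype.subsetP => _ /fintype.imageP[w + ->].
  rewrite !inE => -[_ [u Au <-] uw]; exists u => //.
  apply: eq_from_tnth => i; rewrite -uw !tnth_mktuple /compl negbK //.
apply/eqP; rewrite eqn_leq le /=; apply: leq_trans (le (compl @` A)).
by apply: word_count_le => w Aw; exists (compl w); [exists w|rewrite complK].
Qed.

Lemma word_count_le_size A n (l : seq (seq bool)) :
  (forall w, A w -> mkseq w n \in l) -> (word_count A n <= size l)%N.
Proof.
move=> hA; rewrite /word_count cardE -(size_map val); apply: uniq_leq_size.
  by rewrite (map_inj_uniq val_inj) enum_uniq.
move=> _ /mapP[w + ->]; rewrite mem_enum !inE => -[u Au <-].
rewrite (_ : val _ = mkseq u n); first exact: hA.
by rewrite /mkseq -val_enum_ord -map_comp.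
Qed.

(* The state k is the length of the current match with b (0 if none); a symbol 1
   exceeding b k ends the match and starts a new one. *)
Fixpoint greedy_words b n k : seq (seq bool) :=
  if n is n'.+1 then
    if k == 0%N then map (cons false) (greedy_words b n' 0) ++
                     map (cons true) (greedy_words b n' 1)
    else if b k then map (cons true) (greedy_words b n' k.+1)
    else map (cons false) (greedy_words b n' k.+1) ++
         map (cons true) (greedy_words b n' 1)
  else [:: [::]].

(** In a state [k > 0] the remaining string dominates [wshift k b]: a first symbol below [b k] is
    impossible, an equal one hands the bound on to [k + 1], and a larger one starts a new match,
    whose bound comes from the hypothesis on shifts beginning with 1. *)
Lemma greedy_wordsP b n k w : b 0%N ->
  (forall i, w i = true -> lex_le b (wshift i w)) ->
  ((0 < k)%N -> lex_le (wshift k b) w) -> mkseq w n \in greedy_words b n k.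
Proof.
move=> b0; elim: n k w => [|n IH] k w hw hk; first by rewrite inE.
have -> : mkseq w n.+1 = w 0%N :: mkseq (wshift 1 w) n.
  rewrite /mkseq /= -[1%N]/(1 + 0)%N iotaDl -map_comp.
  by congr cons; apply: eq_map => i.
have hw1 i : wshift 1 w i = true -> lex_le b (wshift i (wshift 1 w)).
  by rewrite wshift_wshift; exact: hw.
have cons_in c k' l1 l2 : mkseq (wshift 1 w) n \in greedy_words b n k' ->
    c :: mkseq (wshift 1 w) n \in
      l1 ++ map (cons c) (greedy_words b n k') ++ l2.
  by move=> h; rewrite !mem_cat map_f ?orbT.
have start : w 0%N -> mkseq (wshift 1 w) n \in greedy_words b n 1.
  move=> w0; apply: IH => // _; apply: lex_le_wshift1; first by rewrite b0 w0.
  by have := hw 0%N w0; rewrite wshift0.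
rewrite /=; case: eqVneq => [k0|kn0].
  case w0 : (w 0%N).
    by have := cons_in true 1%N (map (cons false) (greedy_words b n 0)) nil (start w0); rewrite cats0.
  exact: (cons_in false 0%N nil _ (IH 0%N _ hw1 _)).
have := hk; rewrite lt0n => /(_ kn0) le.
have next : b k = w 0%N -> mkseq (wshift 1 w) n \in greedy_words b n k.+1.
  move=> e; apply: IH => // _; rewrite -addn1 -wshift_wshift.
  by apply: lex_le_wshift1 => //; rewrite /wshift addn0.
case bk : (b k); case w0 : (w 0%N).
- by have := cons_in true k.+1 nil nil (next _); rewrite cats0 /=; apply; rewrite bk.
- case: le => [[[|m] [h]]|e]; rewrite ?/wshift ?addn0 ?bk ?w0 //.
    by move=> _ _; have := h 0%N isT; rewrite /wshift addn0 bk w0.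
  by have := congr1 (@^~ 0%N) e; rewrite /wshift addn0 bk w0.
- by have := cons_in true 1%N (map (cons false) (greedy_words b n k.+1)) nil (start w0); rewrite cats0.
- by apply: (cons_in false k.+1 nil _ (next _)); rewrite bk.
Qed.

(** [V] is a supersolution of the counting recursion of the automaton at rate [c], so it dominates
    the counts by induction on the length. *)
Lemma size_greedy_words (R : realType) b (V : nat -> R) (c : R) : 0 <= c ->
  (forall k, 1 <= V k) -> V 0%N + V 1%N <= c * V 0%N ->
  (forall k, (0 < k)%N -> V k.+1 + (if b k then 0 else V 1%N) <= c * V k) ->
  forall n k, (size (greedy_words b n k))%:R <= V k * c ^+ n.
Proof.
move=> c0 V1 h0 hk; elim=> [|n IH] k /=; first by rewrite mulr1.
have cn : 0 <= c ^+ n by rewrite exprn_ge0.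
rewrite exprS mulrA [V k * c]mulrC; case: eqVneq => [->|kn0].
  rewrite size_cat !size_map natrD; apply: le_trans (lerD (IH _) (IH _)) _.
  by rewrite -mulrDl ler_wpM2r.
have := hk k; rewrite lt0n => /(_ kn0).
case: (b k) => h; rewrite ?size_cat !size_map.
  by apply: le_trans (IH _) _; rewrite ler_wpM2r //; lra.
rewrite natrD; apply: le_trans (lerD (IH _) (IH _)) _.
by rewrite -mulrDl ler_wpM2r.
Qed.

End WordCounts.

(** * Entropy as the limit of a subadditive sequence *)

Section Entropy.
Context {R : realType}.
Implicit Types (A : set string) (u : nat -> R).

(** Fekete's lemma: divide [n] by an [M] whose quotient nearly attains the infimum; the remainder
    costs at most a constant, negligible after division by [n]. *)
Lemma fekete u : (forall n, 0 <= u n) ->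
  (forall m n, u (m + n)%N <= u m + u n) ->
  u n / n%:R @[n --> \oo] --> inf [set u n / n%:R | n in [set n | (0 < n)%N]].
Proof.
move=> u0 uD; set S := [set _ | _ in _].
have lbS : has_lbound S by exists 0 => _ [n _ <-]; rewrite divr_ge0.
have S0 : S !=set0 by exists (u 1%N / 1), 1%N.
apply/cvgrPdist_le => e e0.
have e20 : 0 < e / 2 by rewrite divr_gt0.
have [_ [M /= M0 <-] hM] := inf_adherent e20 (conj S0 lbS).
set L := inf S in hM *.
have umul k r : u (k * M + r)%N <= k%:R * u M + u r.
  elim: k => [|k IH]; first by rewrite mul0r add0r.
  by rewrite mulSn -addnA -natr1; have := uD M (k * M + r)%N; lra.
have ur r : u r <= u 0%N + r%:R * u 1%N.
  elim: r => [|r IH]; first by rewrite mul0r addr0.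
  by rewrite -addn1 natrD; have := uD r 1%N; lra.
(* [C] bounds [u r] for every remainder [r < M]; from the index chosen below on, [C / n] is at most
   [e / 2]. *)
pose C := u 0%N + M%:R * u 1%N.
have C0 : 0 <= C by rewrite addr_ge0 // mulr_ge0.
exists (Num.truncn (C / (e / 2))).+1 => // n /= hn.
have n0 : (0 < n)%N by apply: leq_trans hn.
have nR : 0 < n%:R :> R by rewrite ltr0n.
have MR : 0 < M%:R :> R by rewrite ltr0n.
have Ln : L <= u n / n%:R by apply: ge_inf => //; exists n.
have Cn : C <= e / 2 * n%:R.
  rewrite mulrC -ler_pdivrMr //; apply: ltW; apply: lt_le_trans (truncnS_gt _) _.
  by rewrite ler_nat.
have un : u n <= (u M / M%:R) * n%:R + C.
  have hr : u (n %% M)%N <= C.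
    apply: le_trans (ur _) _; rewrite lerD2l ler_wpM2r // ler_nat.
    by rewrite ltnW // ltn_mod.
  rewrite {1}(divn_eq n M); apply: le_trans (umul _ _) _; apply: lerD => //.
  rewrite mulrC -[leRHS]mulrA ler_wpM2l //.
  by rewrite [leRHS]mulrC ler_pdivlMr // -natrM ler_nat leq_trunc_div.
rewrite distrC ger0_norm ?subr_ge0 // lerBlDr ler_pdivrMr //.
by apply: le_trans un _; have := ler_wpM2r (ltW nR) (ltW hM); lra.
Qed.

(** Fekete's lemma for the logarithms of the word counts. As the limit is an infimum, the entropy
    also bounds each finite term from below. *)
Lemma string_entropy_cvg A : A !=set0 -> (forall (i : nat) w, A w -> A (wshift i w)) ->
  ln (word_count A n)%:R / n%:R @[n --> \oo] --> (string_entropy A : R) /\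
  forall n, (0 < n)%N -> string_entropy A <= ln (word_count A n)%:R / n%:R :> R.
Proof.
move=> A0 hA; pose u n : R := ln (word_count A n)%:R.
have c1 n : 1 <= (word_count A n)%:R :> R by rewrite ler1n word_count_gt0.
have u0 n : 0 <= u n by rewrite ln_ge0.
have c0 n : ((word_count A n)%:R : R) \is Num.pos by rewrite posrE ltr0n word_count_gt0.
have uD m n : u (m + n)%N <= u m + u n.
  rewrite /u -lnM // -natrM ler_ln ?ler_nat ?word_count_submul //.
  by rewrite posrE ltr0n muln_gt0 !word_count_gt0.
have F := fekete u0 uD.
have E : string_entropy A = inf [set u n / n%:R | n in [set n | (0 < n)%N]].
  exact: cvg_lim F.
rewrite E; split=> // n n0; apply: ge_inf; last by exists n.
by exists 0 => _ [m _ <-]; rewrite divr_ge0.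
Qed.

Lemma expR_entropy_le A n : A !=set0 -> (forall (i : nat) w, A w -> A (wshift i w)) ->
  expR (string_entropy A) ^+ n <= (word_count A n)%:R :> R.
Proof.
move=> A0 hA; case: n => [|n]; first by rewrite ler1n word_count_gt0.
rewrite -expRM_natl -ler_ln ?posrE ?expR_gt0 ?ltr0n ?word_count_gt0 //.
rewrite expRK mulrC -ler_pdivlMr ?ltr0n //.
by case: (string_entropy_cvg A0 hA) => _; exact.
Qed.

Lemma expR_entropy_ge A (a : R) : A !=set0 -> (forall (i : nat) w, A w -> A (wshift i w)) ->
  0 < a -> (forall n, a ^+ n <= (word_count A n)%:R) -> a <= expR (string_entropy A).
Proof.
move=> A0 hA a0 h; case: (string_entropy_cvg A0 hA) => cv _.
rewrite -(lnK (_ : a \is Num.pos)) ?posrE // ler_expR.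
apply: (cvgr_to_ge cv).
exists 1%N => // n /= n0; rewrite ler_pdivlMr ?ltr0n // mulrC mulr_natl -lnXn //.
by rewrite ler_ln ?posrE ?exprn_gt0 // ltr0n word_count_gt0.
Qed.

Lemma string_entropy_compl A : string_entropy (compl @` A) = string_entropy A :> R.
Proof.
rewrite /string_entropy; congr (limn _); apply/funext => n.
by rewrite -/(word_count _ n) word_count_compl.
Qed.

End Entropy.

(** * Comparison with uniform maps *)

Section KneadingSequences.
Context {R : realType} (q : R) (f0 f1 : R -> R).
Context (hT : lorenz_system q f0 f1).

Let alpha := itin_lower q f0 f1 q.
Let beta := itin_upper q f0 f1 q.

Let q01 : 0 <= q <= 1. Proof. by case: hT => /andP[q0 q1] *; rewrite !ltW. Qed.

Lemma addr_upperP w : addr_upper q f0 f1 w <->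
  forall i, (w i = false -> lex_lt (wshift i w) alpha) /\
            (w i = true -> lex_le beta (wshift i w)).
Proof.
have [s [g hg]] := lorenz_inverse_branches hT.
rewrite /alpha /beta itin_lowerE itin_upperE; apply: iff_trans (upper_itinP hg w).
rewrite /addr_upper itin_upperE; split=> [[x]|[x hx]].
  by rewrite /= in_itv; exists x.
by exists x; rewrite //= in_itv.
Qed.

Lemma addr_lowerP w : addr_lower q f0 f1 w <->
  forall i, (w i = false -> lex_le (wshift i w) alpha) /\
            (w i = true -> lex_lt beta (wshift i w)).
Proof.
have [s [g hg]] := lorenz_inverse_branches hT.
rewrite /alpha /beta itin_lowerE itin_upperE; apply: iff_trans (lower_itinP hg w).
rewrite /addr_lower itin_lowerE; split=> [[x]|[x hx]].
  by rewrite /= in_itv; exists x.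
by exists x; rewrite //= in_itv.
Qed.

Lemma addr_upper_beta : addr_upper q f0 f1 beta.
Proof. by exists q; rewrite //= in_itv. Qed.

Lemma addr_lower_alpha : addr_lower q f0 f1 alpha.
Proof. by exists q; rewrite //= in_itv. Qed.

Lemma alpha0 : alpha 0%N = false.
Proof. by rewrite /alpha /itin_lower /= ltxx. Qed.

Lemma beta0 : beta 0%N = true.
Proof. by rewrite /beta /itin_upper /= lexx. Qed.

Lemma alpha_lt_beta : lex_lt alpha beta.
Proof. by exists 0%N; rewrite alpha0 beta0. Qed.

Lemma itin_upper_le x y : 0 <= x <= 1 -> 0 <= y <= 1 -> x <= y ->
  lex_le (itin_upper q f0 f1 x) (itin_upper q f0 f1 y).
Proof.
have [s [g hg]] := lorenz_inverse_branches hT.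
rewrite itin_upperE; exact: (itin_le hg (coding_upper _)).
Qed.

(** Both address spaces are handled together because the reflection exchanges them. *)
Definition address_space A := A = addr_upper q f0 f1 \/ A = addr_lower q f0 f1.

Lemma address_space_neq0 A : address_space A -> A !=set0.
Proof.
by case=> ->; [exists beta; exact: addr_upper_beta|exists alpha; exact: addr_lower_alpha].
Qed.

Lemma address_space_wshift A : address_space A ->
  forall (i : nat) w, A w -> A (wshift i w).
Proof.
case=> -> i w; [move/addr_upperP|move/addr_lowerP] => h; [apply/addr_upperP|apply/addr_lowerP];
  by move=> k; rewrite wshift_wshift; exact: h.
Qed.

Lemma address_space_ge_beta A : address_space A ->
  forall w, A w -> forall i, w i = true -> lex_le beta (wshift i w).
Proof.
by case=> -> w; [move/addr_upperP|move/addr_lowerP] => h i /(h i).2 //; left.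
Qed.

(** The string 0111..., the greatest one that begins with 0. *)
Definition top_string : string := fun k => (0 < k)%N.

(** The fixed point 1 has itinerary 111..., and strict monotonicity of itineraries makes it the only
    point that does. *)
Lemma alpha_topP : alpha = top_string <-> lorenz_lower q f0 f1 q = 1.
Proof.
have [s [g hg]] := lorenz_inverse_branches hT.
have [q0 q1] : 0 < q /\ q < 1 by case: hT => /andP.
have one01 : 0 <= (1 : R) <= 1 by rewrite ler01 lexx.
have f11 : f1 1 = 1 by case: hT => _ _ _ [].
have itin1 : itin_lower q f0 f1 1 = fun=> true.
  apply/funext => k; rewrite /itin_lower.
  suff -> : iter k (lorenz_lower q f0 f1) 1 = 1 by rewrite q1.
  by elim: k => //= k ->; rewrite /lorenz_lower leNgt q1.
have tailE : wshift 1 alpha = itin_lower q f0 f1 (lorenz_lower q f0 f1 q).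
  by rewrite /alpha itin_lowerE lorenz_lowerE wshift_itin.
split=> [e|e]; last first.
  apply/funext => -[|k]; first by rewrite alpha0.
  by have := congr1 (@^~ k) tailE; rewrite /wshift add1n e itin1.
have hy : 0 <= lorenz_lower q f0 f1 q <= 1.
  by rewrite lorenz_lowerE; exact: (step_range hg (coding_lower q) q01).
apply/eqP; rewrite eq_le; case/andP: hy => y0 y1; rewrite y1 /= leNgt.
apply/negP; have := itin_lt hg (coding_lower q) (coding_lower q) _ one01.
move=> /(_ (lorenz_lower q f0 f1 q)); rewrite y0 y1 => /(_ isT) h /h.
rewrite -itin_lowerE -tailE itin1 e.
have -> : wshift 1 top_string = fun=> true by apply/funext.
exact: lex_lt_irr.
Qed.

End KneadingSequences.

Lemma lex_le_top w : w 0%N = false -> lex_le w top_string.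
Proof.
move=> w0; have [|[[n [hn tn wn]]|->]] := lex_total w top_string; [by left| |by right].
by case: n hn tn wn => // _ _; rewrite w0.
Qed.

Lemma lex_le_anti w v : lex_le w v -> lex_le v w -> w = v.
Proof. by case=> // h /(lex_lt_le_trans h) /lex_lt_irr. Qed.

(** * Orbit separation and word counts of uniform maps *)

Section UniformMaps.
Context {R : realType} (a p : R).
Context (a12 : 1 < a < 2) (hp : 1 - a^-1 <= p <= a^-1).

Let hU := unif_lorenz_system a12 hp.
Let a0 : 0 < a. Proof. by move: a12; lra. Qed.
Let b := branch (unif0 a) (unif1 a).

Lemma unif_step_dist c x y : c x = c y -> step b c x - step b c y = a * (x - y).
Proof. by rewrite /step => ->; case: (c y); rewrite /b /= /unif0 /unif1; lra. Qed.

(** Both branches have slope [a], so orbits with equal symbols separate by exactly this factor at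
    each step. *)
Lemma unif_iter_dist c x y n :
  (forall k, (k < n)%N -> itin b c x k = itin b c y k) ->
  iter n (step b c) x - iter n (step b c) y = a ^+ n * (x - y).
Proof.
elim: n => [|n IH] h; first by rewrite mul1r.
rewrite /= unif_step_dist; last exact: h.
by rewrite IH => [|k kn]; [rewrite exprS mulrA|rewrite h // ltnW].
Qed.

(** Points with the same word of length [n] are at most [a ^- n] apart, so equally spaced points
    with a larger gap all have different words. *)
Lemma unif_word_count_ge c n : coding p c ->
  a ^+ n <= (word_count (itin b c @` `[0, 1]) n)%:R.
Proof.
move=> hc; have [s [g hg]] := lorenz_inverse_branches hU.
have an : 0 < a ^+ n by rewrite exprn_gt0.
have ex : exists M, a ^+ n <= M.+1%:R.
  by exists (Num.truncn (a ^+ n)); rewrite ltW // truncnS_gt.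
(* Minimality gives [M < a ^+ n] when [M > 0], so the gap [1 / M] exceeds [a ^- n], while the
   [M + 1] points are still numerous enough. *)
case: (ex_minnP ex) => M hM Mmin; apply: le_trans hM _; rewrite ler_nat.
(* For [M = 0] the single point is 0, since division by zero returns 0. *)
pose pt (j : nat) : R := j%:R / M%:R.
have pt01 (j : 'I_M.+1) : 0 <= pt j <= 1.
  rewrite divr_ge0 //=; case: (posnP M) => [M0|M0].
    rewrite /pt; have -> : M%:R = 0 :> R by rewrite M0.
    by rewrite invr0 mulr0.
  by rewrite ler_pdivrMr ?ltr0n // mul1r ler_nat -ltnS.
pose f (j : 'I_M.+1) := [tuple itin b c (pt j) i | i < n].
have fI : injective f.
  move=> j j' e; apply/eqP; apply/negPn/negP => ne.
  have M0 : (0 < M)%N.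
    rewrite lt0n; apply: contraNneq ne => Me.
    have j0 (i : 'I_M.+1) : nat_of_ord i = 0%N.
      by apply/eqP; rewrite -leqn0 (@leq_trans M) ?Me // -ltnS.
    by apply/eqP/val_inj; rewrite /= !j0.
  have Ma : M%:R < a ^+ n.
    rewrite ltNge; apply/negP => h; have := Mmin M.-1; rewrite prednK // => /(_ h).
    by rewrite leqNgt ltn_predL M0.
  have d1 : a ^+ n * `|pt j - pt j'| <= 1.
    rewrite -{1}(gtr0_norm an) -normrM -(@unif_iter_dist c) => [|k kn]; last first.
      by move/(congr1 (fun t => tnth t (Ordinal kn))): e; rewrite !tnth_mktuple.
    have := iter_step_range hg n hc (pt01 j); have := iter_step_range hg n hc (pt01 j').
    by rewrite -/b ler_norml; lra.
  have : 1 <= `|pt j - pt j'| * M%:R.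
    rewrite -[X in _ * X](ger0_norm (ler0n R M)) -normrM mulrBl !divfK ?pnatr_eq0 -?lt0n //.
    have {}ne : (j : nat) != j' by [].
    case/orP: (leq_total j j') => le.
      rewrite distrC ger0_norm -?natrB ?ler0n // ler1n subn_gt0.
      by rewrite ltn_neqAle ne.
    rewrite ger0_norm -?natrB ?ler0n // ler1n subn_gt0.
    by rewrite ltn_neqAle eq_sym ne.
  move=> d2; have d0 : 0 < `|pt j - pt j'|.
    rewrite lt0r normr_ge0 andbT; apply: contraTneq d2 => ->.
    by rewrite mul0r ler10.
  by have := Ma; rewrite -(ltr_pM2l d0); lra.
rewrite -[X in (X <= _)%N]card_ord -(fintype.card_image fI).
apply: subset_leq_card; apply/fintype.subsetP => _ /fintype.imageP[j _ ->].
rewrite !inE; exists (itin b c (pt j)) => //; exists (pt j) => //=.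
by rewrite in_itv /=.
Qed.



Lemma unif_addr_upperE : unif_addr_upper a p = itin b (upper_code p) @` `[0, 1].
Proof. by rewrite /unif_addr_upper /addr_upper itin_upperE. Qed.

Lemma unif_addr_lowerE : unif_addr_lower a p = itin b (lower_code p) @` `[0, 1].
Proof. by rewrite /unif_addr_lower /addr_lower itin_lowerE. Qed.

Lemma mu_lower_topP : mu_lower a p p = top_string <-> p = a^-1.
Proof.
apply: iff_trans (alpha_topP hU) _; rewrite /lorenz_lower lexx /unif0.
have an0 : a != 0 by rewrite gt_eqF.
by split=> [h|->]; [rewrite -[RHS]mulr1 -h mulKf|rewrite mulfV].
Qed.

End UniformMaps.

(** * Systems with [T^-(q) = 1] compared with the uniform map at [p = a^-1] *)

Section FullUpperBranch.
Context {R : realType} (q : R) (f0 f1 : R -> R).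
Context (hT : lorenz_system q f0 f1) (htop : lorenz_lower q f0 f1 q = 1).
Context (a : R) (a12 : 1 < a < 2).

Let alpha := itin_lower q f0 f1 q.
Let beta := itin_upper q f0 f1 q.
Let p := a^-1.
Let gamma := mu_upper a p p.

Let alphaE : alpha = top_string. Proof. exact/(alpha_topP hT). Qed.

Let a0 : 0 < a. Proof. by move: a12; lra. Qed.

Let aV : a * p = 1. Proof. by rewrite /p divff // gt_eqF. Qed.

Lemma inv_admissible : 1 - a^-1 <= a^-1 <= a^-1.
Proof.
rewrite lexx andbT; have : 0 < p by rewrite invr_gt0.
by move: a12 aV; rewrite -/p; nra.
Qed.

Let hU := unif_lorenz_system a12 inv_admissible.

Let mu_lowerE : mu_lower a p p = alpha.
Proof. by rewrite alphaE; apply/(mu_lower_topP a12 inv_admissible). Qed.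

(** The two systems share [alpha], and the shifts of [beta] that begin with 1 are at least [beta],
    hence strictly above [gamma]. *)
Lemma unif_addr_beta : lex_lt gamma beta ->
  unif_addr_upper a p beta /\ unif_addr_lower a p beta.
Proof.
move=> gb; have hb := (addr_upperP hT beta).1 (addr_upper_beta hT).
split; [apply/(addr_upperP hU)|apply/(addr_lowerP hU)] => i;
  rewrite -/(mu_lower a p p) -/(mu_upper a p p) -/gamma mu_lowerE;
  have [h0 h1] := hb i; split=> [/h0|/h1] //.
- by move=> h; left; exact: lex_lt_le_trans h.
- by left.
- by exact: lex_lt_le_trans.
Qed.

Lemma addr_lower_proper : lex_lt gamma beta ->
  addr_lower q f0 f1 `<` unif_addr_lower a p.
Proof.
move=> gb; split; last first.
  (* The witness of properness is [beta], which fails the strict bound by itself at index 0. *)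
  move/(_ _ (unif_addr_beta gb).2)/(addr_lowerP hT) => /(_ 0%N)[_].
  by rewrite wshift0 => /(_ (beta0 _ _ _)) /lex_lt_irr.
move=> w /(addr_lowerP hT) hw; apply/(addr_lowerP hU) => i.
rewrite -/(mu_lower a p p) -/(mu_upper a p p) -/gamma mu_lowerE.
by have [h0 h1] := hw i; split=> // /h1; exact: lex_lt_trans.
Qed.

Lemma addr_upper_proper : lex_lt gamma beta ->
  addr_upper q f0 f1 `<` unif_addr_upper a p.
Proof.
move=> gb; split; last first.
  (* Here the witness is [gamma], which lies below the bound [beta]. *)
  move/(_ _ (addr_upper_beta hU))/(addr_upperP hT) => /(_ 0%N)[_].
  rewrite wshift0 => /(_ (beta0 _ _ _)) h.
  by exact: (lex_lt_irr (lex_lt_le_trans gb h)).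
move=> w /(addr_upperP hT) hw; apply/(addr_upperP hU) => i.
rewrite -/(mu_lower a p p) -/(mu_upper a p p) -/gamma mu_lowerE.
by have [h0 h1] := hw i; split=> // /h1 h; left; exact: lex_lt_le_trans h.
Qed.

(** If [beta <= gamma], the reverse inclusion holds, against properness. *)
Lemma lt_of_addr_upper_proper :
  addr_upper q f0 f1 `<` unif_addr_upper a p -> lex_lt gamma beta.
Proof.
move=> [sub nsub]; have [//|bg] := lex_total gamma beta.
case: nsub => w /(addr_upperP hU) hw; apply/(addr_upperP hT) => i.
have [h0 h1] := hw i; split=> [/h0|/h1].
  by rewrite -/(mu_lower a p p) mu_lowerE.
by exact: lex_le_trans.
Qed.

(** Membership bounds [alpha], the greatest string beginning with 0, by the lower kneading sequence
    at [p'], so the two are equal. This gives uniqueness of the parameter for the inclusions. *)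
Lemma unif_addr_lower_alpha_inv p' : 1 - a^-1 <= p' <= a^-1 ->
  unif_addr_lower a p' alpha -> p' = a^-1.
Proof.
move=> hp' /(addr_lowerP (unif_lorenz_system a12 hp')) => /(_ 0%N)[].
rewrite wshift0 -/(mu_lower a p' p') => /(_ (alpha0 _ _ _)) h _.
apply/(mu_lower_topP a12 hp'); apply: lex_le_anti; last by rewrite -alphaE.
exact/lex_le_top/alpha0.
Qed.

Lemma word_count_ge_expr A : address_space q f0 f1 A -> ~ lex_lt gamma beta ->
  forall n, a ^+ n <= (word_count A n)%:R.
Proof.
move=> hA ngb n; have bg : lex_le beta gamma by case: (lex_total gamma beta).
have hp := inv_admissible.
case: hA => ->.
  apply: le_trans (unif_word_count_ge a12 hp n (coding_upper _)) _.
  rewrite -unif_addr_upperE ler_nat; apply: word_count_le => w.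
  move=> /(addr_upperP hU) hw; apply/(addr_upperP hT) => i.
  have [h0 h1] := hw i; split=> [/h0|/h1]; first by rewrite -/(mu_lower a p p) mu_lowerE.
  exact: lex_le_trans.
apply: le_trans (unif_word_count_ge a12 hp n (coding_lower _)) _.
rewrite -unif_addr_lowerE ler_nat; apply: word_count_le => w.
move=> /(addr_lowerP hU) hw; apply/(addr_lowerP hT) => i.
have [h0 h1] := hw i; split=> [/h0|/h1]; first by rewrite -/(mu_lower a p p) mu_lowerE.
exact: lex_le_lt_trans.
Qed.

Lemma word_count_exp_bound A : address_space q f0 f1 A -> lex_lt gamma beta ->
  exists c K, [/\ 0 < c, c < a, 0 < K & forall n, (word_count A n)%:R <= K * c ^+ n].
Proof.
move=> hA gb; have [y] := (unif_addr_beta gb).1.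
rewrite /= in_itv /= => hy ey.
have [s [g hg]] := lorenz_inverse_branches hU.
(* If [y <= p], monotonicity would give [beta <= gamma]. The strict inequality makes [a * y - 1]
   positive. *)
have py : p < y.
  rewrite ltNge; apply/negP => yp; apply: (@lex_lt_irr gamma).
  apply: lex_lt_le_trans gb _; rewrite -ey; apply: (itin_upper_le hU) => //.
  by case: hU => /andP[p0 p1] _ _ _ _; rewrite !ltW.
pose Y k := iter k (step (branch (unif0 a) (unif1 a)) (upper_code p)) y.
have Y01 k : 0 <= Y k <= 1 by exact: (iter_step_range hg k (coding_upper _) hy).
have YS k : Y k.+1 = if beta k then a * Y k + 1 - a else a * Y k.
  rewrite -ey itin_upperE /itin -/(Y k) /Y /= {1}/step -/(Y k).
  by case: (upper_code p _).
have b0 : beta 0%N = true by exact: beta0.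
have e0 : 0 < a * y - 1 by rewrite subr_gt0 -aV ltr_pM2l.
(* This value yields [W 1 = (a - 1) * r]. Then for either symbol [beta k] the successor weights of a
   state [k > 0] sum to exactly [a * W k - (a - 1)]. *)
pose r := (a * y - 1)^-1.
have r0 : 0 < r by rewrite invr_gt0.
have re : (a * y - 1) * r = 1 by rewrite mulfV ?gt_eqF.
have a1 : 0 < a - 1 by move: a12; lra.
(* Since [W k <= 1 + r], the slack [a - 1] pays for lowering the rate from [a] to [a - d]. *)
pose d := (a - 1) / (1 + r).
have dr : d * (1 + r) = a - 1 by rewrite divfK // gt_eqF // addr_gt0.
have d0 : 0 < d by rewrite divr_gt0 // addr_gt0.
have da : d < a - 1 by rewrite -dr ltr_pMr //; lra.
pose W k := 1 + (1 - Y k) * r.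
have W1 : W 1%N = (a - 1) * r.
  by rewrite /W YS b0 /Y /=; lra.
(* State 0 loops to itself, so its weight must be at least [V 1 / (c - 1)] with [c = a - d]; the
   added 1 keeps it at least 1. *)
pose V k := if k is 0 then 1 + W 1%N / (a - d - 1) else W k.
have Vge k : 1 <= V k.
  case: k => [|k] /=; rewrite lerDl.
    by rewrite W1; apply: divr_ge0; [apply/ltW/mulr_gt0|lra].
  by apply: mulr_ge0 (ltW r0); rewrite subr_ge0; case/andP: (Y01 k.+1).
exists (a - d), (V 0%N); split; [lra|lra|exact: lt_le_trans (Vge _)|move=> n].
have hsz := @size_greedy_words R beta V (a - d).
apply: le_trans (hsz _ Vge _ _ n 0%N); last 3 first.
- lra.
- have e : (a - d - 1) * (W 1%N / (a - d - 1)) = W 1%N.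
    by rewrite mulrC divfK // gt_eqF //; lra.
  by rewrite /=; move: e; set z := W 1%N / _; lra.
- case=> // k _; rewrite /V.
  have dW : d * W k.+1 <= a - 1.
    rewrite -dr; apply: (ler_wpM2l (ltW d0)); rewrite /W lerD2l -[leRHS]mul1r ler_wpM2r ?(ltW r0) //.
    by have := Y01 k.+1; lra.
  rewrite mulrBl W1; move: dW; rewrite /W (YS k.+1); case: (beta _); lra.
rewrite ler_nat; apply: word_count_le_size => w Aw.
by apply: greedy_wordsP => //; exact: (address_space_ge_beta hT hA Aw).
Qed.

Lemma entropy_ltP A : address_space q f0 f1 A ->
  expR (string_entropy A) < a <-> lex_lt gamma beta.
Proof.
move=> hA; have A0 := address_space_neq0 hT hA; have hs := address_space_wshift hT hA.
split=> [ha|gb].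
  apply: contrapT => /(word_count_ge_expr hA) h; move: ha.
  by rewrite ltNge expR_entropy_ge.
have [c [K [c0 ca K0 hK]]] := word_count_exp_bound hA gb.
rewrite ltNge; apply/negP => ae.
(* Entropy at least [ln a] would give [a ^+ m <= K * c ^+ m], so [(a / c) ^+ m / K] would stay
   bounded by 1 although [a / c > 1]. *)
have : K^-1 = 0; last by move=> h; move: K0; rewrite -invr_gt0 h ltxx.
have ac : 1 < a / c by rewrite ltr_pdivlMr // mul1r.
apply: (eq0_of_expr_le1 ac); first by rewrite invr_ge0 ltW.
move=> m; rewrite expr_div_n -mulrA -invfM -ler_pdivlMr; last first.
  by rewrite invr_gt0 mulr_gt0 // exprn_gt0.
rewrite invrK mul1r mulrC; apply: le_trans (hK m).
apply: le_trans (expR_entropy_le m A0 hs).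
by rewrite lerXn2r // nnegrE ?expR_ge0 // ltW.
Qed.

Lemma unique_kneading_matchP :
  unique (fun p' : R =>
    [/\ 1 - a^-1 <= p' <= a^-1,
        alpha = mu_lower a p' p',
        lex_lt (mu_lower a p' p') (mu_upper a p' p') &
        lex_lt (mu_upper a p' p') beta]) a^-1 <-> lex_lt gamma beta.
Proof.
split=> [[[_ _ _ //]]|gb]; split=> [|p' [hp' e _ _]].
  split=> //; [exact: inv_admissible|exact: alpha_lt_beta].
by apply/esym/(mu_lower_topP a12 hp'); rewrite -e.
Qed.

Lemma unique_addr_properP :
  unique (fun p' : R =>
    [/\ 1 - a^-1 <= p' <= a^-1,
        addr_lower q f0 f1 `<` unif_addr_lower a p' &
        addr_upper q f0 f1 `<` unif_addr_upper a p']) a^-1 <-> lex_lt gamma beta.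
Proof.
split=> [[[_ _ h] _]|gb]; first exact: lt_of_addr_upper_proper.
split=> [|p' [hp' [sub _] _]].
  by split; [exact: inv_admissible|exact: addr_lower_proper|exact: addr_upper_proper].
by apply/esym/unif_addr_lower_alpha_inv => //; exact/sub/addr_lower_alpha.
Qed.

End FullUpperBranch.

Lemma full_branch_equivalences (R : realType) (q : R) (f0 f1 : R -> R) A (a : R) :
  lorenz_system q f0 f1 -> lorenz_lower q f0 f1 q = 1 -> address_space q f0 f1 A ->
  let cond_a := expR (string_entropy A) < a < 2 in
  let cond_b := 1 < a < 2 /\
    unique (fun p : R =>
      [/\ 1 - a^-1 <= p <= a^-1,
          itin_lower q f0 f1 q = mu_lower a p p,
          lex_lt (mu_lower a p p) (mu_upper a p p) &
          lex_lt (mu_upper a p p) (itin_upper q f0 f1 q)]) a^-1 in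
  let cond_c := 1 < a < 2 /\
    unique (fun p : R =>
      [/\ 1 - a^-1 <= p <= a^-1,
          addr_lower q f0 f1 `<` unif_addr_lower a p &
          addr_upper q f0 f1 `<` unif_addr_upper a p]) a^-1 in
  (cond_a <-> cond_b) /\ (cond_b <-> cond_c).
Proof.
move=> hT htop hA /=; split; split=> [h|[a12]].
(* Every word count is at least 1, so the entropy is nonnegative and [a] exceeds 1. *)
- have a12 : 1 < a < 2.
    case/andP: h => ha ->; rewrite andbT; apply: le_lt_trans ha.
    have A0 := address_space_neq0 hT hA.
    apply: (expR_entropy_ge A0 (address_space_wshift hT hA)) => // n.
    by rewrite expr1n ler1n word_count_gt0.
  split=> //; apply/unique_kneading_matchP => //; apply/(entropy_ltP hT htop a12 hA).
  by case/andP: h.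
- move/(unique_kneading_matchP hT htop a12)/(entropy_ltP hT htop a12 hA) => ->.
  by case/andP: a12.
- case: h => a12 /(unique_kneading_matchP hT htop a12) h; split=> //.
  exact/unique_addr_properP.
- move/(unique_addr_properP hT htop a12) => h; split=> //.
  exact/unique_kneading_matchP.
Qed.

(** * Transport of the statements through the reflection *)

Lemma unique_flip (R : realType) (P P' : R -> Prop) (x : R) :
  (forall p, P p <-> P' (1 - p)) -> unique P (1 - x) <-> unique P' x.
Proof.
move=> h; split=> -[Px u].
  split=> [|p P'p]; first by have := (h _).1 Px; rewrite subKr.
  by have := u (1 - p); rewrite h subKr => /(_ P'p) /addrI /oppr_inj.
split=> [|p /h /u ->]; last by rewrite subKr.
by apply/h; rewrite subKr.
Qed.

Lemma compl_proper (A B : set string) : compl @` A `<` compl @` B <-> A `<` B.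
Proof.
suff sub C D : compl @` C `<=` compl @` D <-> C `<=` D.
  by split=> -[/sub s1 s2]; split=> // /sub.
split=> [h w Cw|h _ [w /h Dw <-]]; last by exists w.
have [|v Dv /(can_inj complK) <- //] := h (compl w).
by exists w.
Qed.

Lemma flip_mu_lower (R : realType) (a p : R) :
  mu_lower a (1 - p) (1 - p) = compl (mu_upper a p p).
Proof. by rewrite /mu_upper -flip_itin_lower flip_unif0 flip_unif1. Qed.

Lemma flip_mu_upper (R : realType) (a p : R) :
  mu_upper a (1 - p) (1 - p) = compl (mu_lower a p p).
Proof. by rewrite /mu_lower -flip_itin_upper flip_unif0 flip_unif1. Qed.

Lemma flip_unif_addr_lower (R : realType) (a p : R) :
  unif_addr_lower a (1 - p) = compl @` unif_addr_upper a p.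
Proof. by rewrite /unif_addr_upper -flip_addr_lower flip_unif0 flip_unif1. Qed.

Lemma flip_unif_addr_upper (R : realType) (a p : R) :
  unif_addr_upper a (1 - p) = compl @` unif_addr_lower a p.
Proof. by rewrite /unif_addr_lower -flip_addr_upper flip_unif0 flip_unif1. Qed.

Theorem theorem1p6 (R : realType) (q : R) (f0 f1 : R -> R)
    (hT : lorenz_system q f0 f1) :
  let alpha := itin_lower q f0 f1 q in
  let beta := itin_upper q f0 f1 q in
  (lorenz_lower q f0 f1 q = 1 ->
   forall a : R,
   let cond_a := expR (entropy q f0 f1) < a < 2 in
   let cond_b := 1 < a < 2 /\
     unique (fun p : R =>
       [/\ 1 - a^-1 <= p <= a^-1,
           alpha = mu_lower a p p,
           lex_lt (mu_lower a p p) (mu_upper a p p) &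
           lex_lt (mu_upper a p p) beta]) a^-1 in
   let cond_c := 1 < a < 2 /\
     unique (fun p : R =>
       [/\ 1 - a^-1 <= p <= a^-1,
           addr_lower q f0 f1 `<` unif_addr_lower a p &
           addr_upper q f0 f1 `<` unif_addr_upper a p]) a^-1 in
   (cond_a <-> cond_b) /\ (cond_b <-> cond_c))
  /\
  (lorenz_upper q f0 f1 q = 0 ->
   forall a : R,
   let cond_a := expR (entropy q f0 f1) < a < 2 in
   let cond_b := 1 < a < 2 /\
     unique (fun p : R =>
       [/\ 1 - a^-1 <= p <= a^-1,
           lex_lt alpha (mu_lower a p p),
           lex_lt (mu_lower a p p) (mu_upper a p p) &
           mu_upper a p p = beta]) (1 - a^-1) in
   let cond_c := 1 < a < 2 /\
     unique (fun p : R =>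
       [/\ 1 - a^-1 <= p <= a^-1,
           addr_lower q f0 f1 `<` unif_addr_lower a p &
           addr_upper q f0 f1 `<` unif_addr_upper a p]) (1 - a^-1) in
   (cond_a <-> cond_b) /\ (cond_b <-> cond_c)).
Proof.
move=> alpha beta; split=> [htop a|hbot a].
  by apply: full_branch_equivalences => //; left.
have hT' := flip_lorenz_system hT.
have htop' : lorenz_lower (1 - q) (flip f1) (flip f0) (1 - q) = 1.
  by rewrite lorenz_lowerE flip_step_lower -lorenz_upperE hbot subr0.
(* The lower address space of the reflected system is taken: it is the complement of the original
   upper one, from which the entropy is read off. *)
have := full_branch_equivalences a hT' htop' (or_intror erefl).
rewrite flip_addr_lower flip_addr_upper string_entropy_compl -/(entropy q f0 f1).
rewrite flip_itin_lower flip_itin_upper -/alpha -/beta.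
have adm p : 1 - a^-1 <= 1 - p <= a^-1 <-> 1 - a^-1 <= p <= a^-1 by split; lra.
(* Complementing reverses the order and exchanges the kneading sequences, so the chain of
   inequalities is read from its other end. *)
have flip_b p : [/\ 1 - a^-1 <= p <= a^-1, lex_lt alpha (mu_lower a p p),
      lex_lt (mu_lower a p p) (mu_upper a p p) & mu_upper a p p = beta] <->
    [/\ 1 - a^-1 <= 1 - p <= a^-1, compl beta = mu_lower a (1 - p) (1 - p),
      lex_lt (mu_lower a (1 - p) (1 - p)) (mu_upper a (1 - p) (1 - p)) &
      lex_lt (mu_upper a (1 - p) (1 - p)) (compl alpha)].
  rewrite flip_mu_lower flip_mu_upper.
  split=> -[/adm h1 h2 h3 h4]; split=> //; try exact/lex_lt_compl.
    by rewrite h4.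
  exact/(can_inj complK).
have flip_c p : [/\ 1 - a^-1 <= p <= a^-1,
      addr_lower q f0 f1 `<` unif_addr_lower a p &
      addr_upper q f0 f1 `<` unif_addr_upper a p] <->
    [/\ 1 - a^-1 <= 1 - p <= a^-1,
      compl @` addr_upper q f0 f1 `<` unif_addr_lower a (1 - p) &
      compl @` addr_lower q f0 f1 `<` unif_addr_upper a (1 - p)].
  rewrite flip_unif_addr_lower flip_unif_addr_upper.
  by split=> -[/adm h1 h2 h3]; split=> //; apply/compl_proper.
move=> [ab bc]; split.
  apply: iff_trans ab _; apply: and_iff_compat_l; apply: iff_sym.
  by apply: unique_flip; exact: flip_b.
apply: iff_trans (iff_trans _ bc) _; apply: and_iff_compat_l.
  by apply: unique_flip; exact: flip_b.
by apply: iff_sym; apply: unique_flip; exact: flip_c.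
Qed.
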